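(* Let $A_1\in\mathbb{R}^{p\times n}$ have full column rank, $A_2\in\mathbb{R}^{q\times n}$, assume that $A_1^TA_1-A_2^TA_2$ is symmetric positive definite, let $S\in\mathbb{R}^{n\times n}$ be symmetric positive definite, and let $\alpha>0$. If $\mu\in\mathbb{C}$ is an eigenvalue of the preconditioned matrix $\mathscr{P}_{\mathrm{BRS}}^{-1}\mathcal{K}$, then $|\mu-1|<1$; i.e., the spectrum of $\mathscr{P}_{\mathrm{BRS}}^{-1}\mathcal{K}$ is entirely contained in a circle centered at $(1,0)$ with radius strictly less than $1$.
   Context: The matrices are $$\mathcal{K}=\begin{bmatrix} I_p & A_1 & 0 \\ -A_1^T & 0 & A_2^T \\ 0 & A_2 & I_q \end{bmatrix},\qquad \mathscr{P}_{\mathrm{BRS}}=\begin{bmatrix} (\alpha+1)I_p & A_1 & 0 \\ -A_1^T & S & 0 \\ 0 & A_2 & (\alpha+1)I_q \end{bmatrix}.$$ The standing assumption is that $A^T\mathcal{J}A=A_1^TA_1-A_2^TA_2$ is symmetric positive definite, where $A=\begin{bmatrix} A_1 \\ A_2 \end{bmatrix}$ and $\mathcal{J}=\mathrm{diag}(I_p,-I_q)$. *)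

(* Defs.v *)
From mathcomp Require Import all_boot all_order all_algebra.
From mathcomp Require Import reals complex.

Set Implicit Arguments.
Unset Strict Implicit.
Unset Printing Implicit Defensive.

Import Order.TTheory GRing.Theory Num.Theory.
Local Open Scope ring_scope.

Definition spdmx (R : realType) (n : nat) (M : 'M[R]_n) : Prop :=
  M \is symmetricmx /\
  forall x : 'cV[R]_n, x != 0 -> 0 < (x^T *m M *m x) 0 0.

(* The three block rows and columns, of sizes p, n, q, are grouped as
   (p + n) + q in both matrices. *)
Definition K_mx (R : realType) (p n q : nat)
    (A1 : 'M[R]_(p, n)) (A2 : 'M[R]_(q, n)) : 'M[R]_(p + n + q) :=
  block_mx (block_mx 1%:M A1 (- A1^T) 0) (col_mx 0 A2^T)
           (row_mx 0 A2)                 1%:M.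

Definition P_BRS (R : realType) (p n q : nat)
    (A1 : 'M[R]_(p, n)) (A2 : 'M[R]_(q, n)) (S : 'M[R]_n) (alpha : R) :
    'M[R]_(p + n + q) :=
  block_mx (block_mx (alpha + 1)%:M A1 (- A1^T) S) (col_mx 0 0)
           (row_mx 0 A2)                           (alpha + 1)%:M.

(* [mu] is a complex eigenvalue of the real matrix [M]. The library's
   [eigenvalue] is stated with row eigenvectors, which gives the same spectrum
   as column eigenvectors. *)
Definition ceigenvalue (R : realType) (m : nat) (M : 'M[R]_m) (mu : complex R) :
    Prop :=
  eigenvalue (map_mx (real_complex R) M) mu.

(* Main.v *)
Require Import Defs.
From mathcomp Require Import all_boot all_order all_algebra.
From mathcomp Require Import ring lra.
From mathcomp Require Import reals complex.

Import Order.TTheory GRing.Theory Num.Theory.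
Local Open Scope ring_scope.
Local Open Scope complex_scope.

(** Write [l = mu - 1]. If [v] is a left eigenvector of [P^-1 K] for [mu], then
    [w = v P^-1 = (x, y, z)] is nonzero and satisfies [w K = (l + 1) w P].
    With [d = alpha + l (alpha + 1)] the three block columns of this equation
    read
      [d x = l y A1^T],  [d z = y A2^T],
      [x A1 + z A2 = (l + 1) (x A1 + y S + z A2)].
    When [d = 0], [l = - alpha / (alpha + 1)] lies in the unit disc. Otherwise
    [y] is nonzero, since [y = 0] would force [x = z = 0]. Multiplying the third
    equation by [d] and by the conjugate transpose of [y] eliminates [x] and [z]
    and leaves
      [(s (alpha + 1) + a) l^2 + (s (2 alpha + 1) + b) l + s alpha = 0],
    where [s], [a], [b] are the Hermitian values at [y] of [S], [A1^T A1] and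
    [A2^T A2]. They are real, [s > 0], [b >= 0], and [a > b] because
    [A1^T A1 - A2^T A2] is positive definite. Schur's criterion
    ([norm_lt1_of_schur]) for a quadratic [c2 l^2 + c1 l + c0] asks for
    [c0 < c2] and [c1 < c2 + c0]; here the second inequality is exactly
    [b < a]. This is [pencil_lt1].

    Invertibility of [P] ([P_BRS_unit]) comes from the same elimination at
    [w P = 0], which leaves [y (A1^T A1 + (alpha + 1) S) = 0]. A uniform radius
    exists because the spectrum is the finite root set of the characteristic
    polynomial. *)

(** Schur's criterion for a real quadratic with nonnegative coefficients. A
    nonreal root has [|l|^2 = c0 / c2 < 1], as its conjugate is the other root.
    A real root cannot be [>= 1], where the quadratic is positive, nor [- t] with
    [t >= 1], where it exceeds [(t - 1) (c2 t - c0) >= 0]. *)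
Lemma norm_lt1_of_schur (R : rcfType) (c2 c1 c0 : R) (l : R[i]) :
  0 <= c0 -> c0 < c2 -> 0 <= c1 -> c1 < c2 + c0 ->
  c2%:C * l ^+ 2 + c1%:C * l + c0%:C = 0 -> `|l| < 1.
Proof.
case: l => u v c0_ge0 c02 c1_ge0 c120.
rewrite normc_def -[X in _ < X]/(1%:C) ltcR /= -sqrtr1 ltr_sqrt ?ltr01 //.
rewrite expr2; simpc => -[re0 im0].
have [v0|v_neq0] := eqVneq v 0.
  rewrite {}v0 in re0 *.
  have u_gt : -1 < u.
    rewrite ltNge; apply/negP => u_le.
    have : 0 <= (- u - 1) * (c2 * (- u) - c0).
      by apply: mulr_ge0; nra.
    nra.
  have u_lt : u < 1.
    rewrite ltNge; apply/negP => u_ge.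
    have : 0 < c2 * (u * u) by rewrite !mulr_gt0 //; lra.
    have : 0 <= c1 * u by rewrite mulr_ge0 //; lra.
    lra.
  nra.
(* Off the real axis, the imaginary part of the equation determines the real
   part [u] of the root, and its real part the squared modulus. *)
have {}im0 : c1 = - (c2 * u) *+ 2.
  by apply: (mulIf v_neq0); rewrite mulr2n; lra.
have : c2 * (u ^+ 2 + v ^+ 2) = c0 by rewrite im0 in re0; lra.
nra.
Qed.

(** For real symmetric [G] and [y = U + i V], the cross terms [V G U^T] and
    [U G V^T] of the Hermitian value are transposes of each other, hence equal
    as [1 x 1] matrices, and cancel. Signs of Hermitian values thus reduce to
    signs of real quadratic forms. *)
Lemma herm_real (R : rcfType) (n : nat) (G : 'M[R]_n) (y : 'rV[R[i]]_n) : G^T = G ->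
  let U := map_mx (@complex.Re R) y in let V := map_mx (@complex.Im R) y in
  (y *m map_mx (real_complex R) G *m (map_mx conjc y)^T) 0 0 =
  ((U *m G *m U^T) 0 0 + (V *m G *m V^T) 0 0)%:C.
Proof.
move=> symG U V.
pose rc := map_mx (real_complex R).
have yE : y = rc _ _ U + 'i *: rc _ _ V.
  by apply/matrixP=> i j; rewrite !mxE; case: (y i j) => a b; simpc.
have ycE : map_mx conjc y = rc _ _ U - 'i *: rc _ _ V.
  by apply/matrixP=> i j; rewrite !mxE; case: (y i j) => a b; simpc.
move: U V @rc yE ycE => U V rc yE ycE.
have cross : V *m G *m U^T = U *m G *m V^T.
  rewrite [RHS]mx11_scalar -tr_scalar_mx -mx11_scalar.
  by rewrite !trmx_mul trmxK symG mulmxA.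
rewrite ycE {1}yE linearB linearZ /= !mulmxDl !mulmxBr -!scalemxAl -!scalemxAr.
rewrite /rc !map_trmx -!map_mxM /= cross scalerA -expr2 sqr_i scaleN1r opprK.
by rewrite addrA subrK rmorphD !mxE.
Qed.

Lemma gram_ge0 (R : rcfType) (m n : nat) (B : 'M[R]_(m, n)) (u : 'rV[R]_n) :
  0 <= (u *m (B^T *m B) *m u^T) 0 0.
Proof.
rewrite !mulmxA -mulmxA -{2}[B]trmxK -trmx_mul mxE.
by apply: sumr_ge0 => i _; rewrite !mxE -expr2 sqr_ge0.
Qed.

Lemma herm_gram (R : rcfType) (m n : nat) (B : 'M[R]_(m, n)) (y : 'rV[R[i]]_n) :
  exists2 b : R, 0 <= b &
  (y *m map_mx (real_complex R) (B^T *m B) *m (map_mx conjc y)^T) 0 0 = b%:C.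
Proof.
rewrite herm_real ?trmx_mul ?trmxK //.
by eexists; last reflexivity; apply: addr_ge0; apply: gram_ge0.
Qed.

Lemma spdmx_sym (R : realType) (n : nat) (M : 'M[R]_n) : spdmx M -> M^T = M.
Proof.
by case=> + _; rewrite is_hermitianmxE expr0 scale1r map_mx_id // => /eqP.
Qed.

Lemma spdmx_gt0 (R : realType) (n : nat) (M : 'M[R]_n) (u : 'rV[R]_n) :
  spdmx M -> u != 0 -> 0 < (u *m M *m u^T) 0 0.
Proof.
by move=> [_ pos] u0; rewrite -{1}[u]trmxK pos // trmx_eq0.
Qed.

Lemma herm_spd (R : realType) (n : nat) (M : 'M[R]_n) (y : 'rV[R[i]]_n) :
  spdmx M -> y != 0 -> exists2 s : R, 0 < s &
  (y *m map_mx (real_complex R) M *m (map_mx conjc y)^T) 0 0 = s%:C.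
Proof.
move=> spdM y_neq0; rewrite herm_real ?spdmx_sym //.
eexists; last reflexivity.
have ge0 (u : 'rV[R]_n) : 0 <= (u *m M *m u^T) 0 0.
  have [->|u_neq0] := eqVneq u 0; first by rewrite !mul0mx mxE.
  exact/ltW/spdmx_gt0.
have [Re0|Re_neq0] := eqVneq (map_mx (@complex.Re R) y) 0; last first.
  by rewrite ltr_pwDl ?spdmx_gt0.
rewrite ltr_wpDl ?spdmx_gt0 //; apply: contraNneq y_neq0 => Im0.
apply/eqP/matrixP=> i j; apply/eqP.
have /matrixP/(_ i j) := Re0; have /matrixP/(_ i j) := Im0; rewrite !mxE.
by rewrite eq_complex /= => -> ->; rewrite eqxx.
Qed.

Lemma mul_row_block3 (F : pzRingType) (p n q : nat)
    (x : 'rV[F]_p) (y : 'rV[F]_n) (z : 'rV[F]_q)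
    (a : 'M_(p, p)) (b : 'M_(p, n)) (c : 'M_(n, p)) (d : 'M_(n, n))
    (e : 'M_(p, q)) (f : 'M_(n, q)) (g : 'M_(q, p)) (h : 'M_(q, n))
    (k : 'M_(q, q)) :
  row_mx (row_mx x y) z *m
    block_mx (block_mx a b c d) (col_mx e f) (row_mx g h) k =
  row_mx (row_mx (x *m a + y *m c + z *m g) (x *m b + y *m d + z *m h))
         (x *m e + y *m f + z *m k).
Proof. by rewrite !mul_row_block mul_row_col mul_mx_row add_row_mx. Qed.

(** A row [(x, y, z)] in the left kernel has [z = 0] and
    [(alpha + 1) x = y A1^T]; eliminating [x] leaves
    [y (A1^T A1 + (alpha + 1) S) = 0] with a positive definite matrix, so
    [y = 0] and then [x = 0]. *)
Lemma P_BRS_unit (R : realType) (p n q : nat)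
    (A1 : 'M[R]_(p, n)) (A2 : 'M[R]_(q, n)) (S : 'M[R]_n) (alpha : R) :
  spdmx S -> 0 < alpha -> P_BRS A1 A2 S alpha \in unitmx.
Proof.
move=> spdS alpha_gt0.
have a1_neq0 : alpha + 1 != 0 by lra.
rewrite -row_free_unit; apply: inj_row_free => w.
rewrite -[w]hsubmxK -[lsubmx w]hsubmxK.
move: (lsubmx (lsubmx w)) (rsubmx (lsubmx w)) (rsubmx w) => {w} x y z.
rewrite mul_row_block3 !mulmx0 !addr0 add0r mulmxN !mul_mx_scalar.
rewrite -[0 in RHS]hsubmxK -[lsubmx 0]hsubmxK !linear0.
move=> /eq_row_mx[/eq_row_mx[eqx eqy] /eqP].
rewrite scaler_eq0 (negPf a1_neq0) /= => /eqP z0.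
rewrite {}z0 mul0mx addr0 in eqy *.
have {}eqx : (alpha + 1) *: x = y *m A1^T.
  by apply/eqP; rewrite -subr_eq0 eqx.
have y0 : y = 0.
  apply/eqP/negPn/negP => y_neq0.
  have : (alpha + 1) *: (x *m A1 + y *m S) *m y^T = 0.
    by rewrite eqy scaler0 mul0mx.
  rewrite scalerDr scalemxAl eqx -mulmxA mulmxDl -scalemxAl.
  move=> /matrixP/(_ 0 0); rewrite mxE [X in _ + X]mxE [RHS]mxE.
  apply/eqP; rewrite gt_eqF // ltr_wpDl ?gram_ge0 //.
  by rewrite mulr_gt0 ?spdmx_gt0 //; lra.
move: eqx; rewrite y0 mul0mx => /eqP.
by rewrite scaler_eq0 (negPf a1_neq0) /= => /eqP->; rewrite !row_mx0.
Qed.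

(** Working with the pencil equation keeps [P^-1] out of the block computation.
    Left vectors are convenient: [K - P] has one off-diagonal block, [A2^T] in
    the last block column, so the outer columns express [d x] and [d z] in terms of [y]. *)
Lemma pencil_lt1 (R : realType) (p n q : nat)
    (A1 : 'M[R]_(p, n)) (A2 : 'M[R]_(q, n)) (S : 'M[R]_n) (alpha : R)
    (mu : R[i]) (w : 'rV[R[i]]_(p + n + q)) :
  spdmx (A1^T *m A1 - A2^T *m A2) -> spdmx S -> 0 < alpha -> w != 0 ->
  w *m map_mx (real_complex R) (K_mx A1 A2) =
    mu *: (w *m map_mx (real_complex R) (P_BRS A1 A2 S alpha)) ->
  `|mu - 1| < 1.
Proof.
move=> spdA spdS alpha_gt0 w_neq0.
pose l : R[i] := mu - 1; pose ac : R[i] := alpha%:C; pose d : R[i] := ac + l * (ac + 1).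
pose cmx m1 m2 (M : 'M[R]_(m1, m2)) := map_mx (real_complex R) M.
pose B1 := cmx _ _ A1; pose B2 := cmx _ _ A2; pose T := cmx _ _ S.
have -> : map_mx (real_complex R) (K_mx A1 A2) =
    block_mx (block_mx 1%:M B1 (- B1^T) 0) (col_mx 0 B2^T) (row_mx 0 B2) 1%:M.
  rewrite !map_block_mx !map_col_mx !map_row_mx !map_mx0 map_mxN !map_mx1.
  by rewrite -!map_trmx.
have -> : map_mx (real_complex R) (P_BRS A1 A2 S alpha) =
    block_mx (block_mx (ac + 1)%:M B1 (- B1^T) T) (col_mx 0 0)
             (row_mx 0 B2) (ac + 1)%:M.
  rewrite !map_block_mx !map_col_mx !map_row_mx !map_mx0 map_mxN !map_scalar_mx.
  by rewrite rmorphD rmorph1 -!map_trmx.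
have -> : mu = l + 1 by rewrite subrK.
rewrite addrK.
move: w_neq0.
rewrite -[w]hsubmxK -[lsubmx w]hsubmxK.
move: (lsubmx (lsubmx w)) (rsubmx (lsubmx w)) (rsubmx w) => {w} x y z w_neq0.
rewrite !mul_row_block3 !mulmx0 !addr0 !add0r !mulmxN !mulmx1 !mul_mx_scalar.
rewrite !scale_row_mx => /eq_row_mx[/eq_row_mx[eqx eqy] eqz].
have {}eqx : d *: x = l *: (y *m B1^T).
  apply/matrixP => i j; move/matrixP/(_ i j): eqx.
  rewrite !mxE; move: (x i j) (\sum_k _) => a u eq_au.
  apply/eqP; rewrite -subr_eq0; apply/eqP.
  transitivity ((l + 1) * ((ac + 1) * a - u) - (a - u)); first by rewrite /d; ring.
  by rewrite -eq_au subrr.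
have {}eqz : d *: z = y *m B2^T.
  apply/matrixP => i j; move/matrixP/(_ i j): eqz.
  rewrite !mxE; move: (z i j) (\sum_k _) => a u eq_au.
  apply/eqP; rewrite -subr_eq0; apply/eqP.
  transitivity ((l + 1) * ((ac + 1) * a) - (u + a)); first by rewrite /d; ring.
  by rewrite -eq_au subrr.
have [d0|d_neq0] := eqVneq d 0.
  (* [d = 0] multiplied by [l] is itself a quadratic of Schur's form. *)
  have quad : (alpha + 1)%:C * l ^+ 2 + alpha%:C * l + 0%:C = 0.
    transitivity (d * l); last by rewrite d0 mul0r.
    by rewrite !(rmorphD, rmorph1) /= -/ac /d; ring.
  by apply: norm_lt1_of_schur quad; lra.
have y_neq0 : y != 0.
  apply: contraNneq w_neq0 => y0; move: eqx eqz.
  rewrite y0 !mul0mx scaler0 => /eqP + /eqP.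
  rewrite !scaler_eq0 !(negPf d_neq0) /= => /eqP-> /eqP->.
  by rewrite !row_mx0.
pose Y := (map_mx conjc y)^T.
have [s s_gt0 sE] := herm_spd _ _ _ _ spdS y_neq0.
have [t t_gt0 tE] := herm_spd _ _ _ _ spdA y_neq0.
have [b b_ge0 bE] := herm_gram _ _ _ A2 y.
(* Applying [h] to the middle block column turns it into a scalar equation;
   the factor [d] then trades [x] and [z] for [y]. *)
pose h (v : 'rV[R[i]]_n) : R[i] := (v *m Y) 0 0.
have hD u v : h (u + v) = h u + h v by rewrite /h mulmxDl mxE.
have hZ c v : h (c *: v) = c * h v by rewrite /h -scalemxAl mxE.
have {}bE : h (y *m B2^T *m B2) = b%:C.
  by rewrite -bE map_mxM mulmxA -map_trmx.
have aE : h (y *m B1^T *m B1) = (b + t)%:C.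
  rewrite rmorphD /= -bE -tE map_mxB !map_mxM mulmxBr !mulmxA -!map_trmx.
  have hB u v : h (u - v) = h u - h v by rewrite -scaleN1r hD hZ mulN1r.
  by rewrite -/(h _) hB addrC subrK.
have xE : d * h (x *m B1) = l * (b + t)%:C.
  by rewrite -aE -!hZ scalemxAl eqx -scalemxAl.
have zE : d * h (z *m B2) = b%:C by rewrite -bE -hZ scalemxAl eqz.
have {}sE : h (y *m T) = s%:C by [].
have /(congr1 h) := eqy; rewrite hZ !hD sE => {}eqy.
have quad : (s * (alpha + 1) + (b + t))%:C * l ^+ 2
    + (s * (2 * alpha + 1) + b)%:C * l + (s * alpha)%:C = 0.
  transitivity (d * ((l + 1) * (h (x *m B1) + s%:C + h (z *m B2))
                     - (h (x *m B1) + h (z *m B2)))); last first.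
    by rewrite -eqy subrr mulr0.
  transitivity ((l + 1) * (d * h (x *m B1) + d * s%:C + d * h (z *m B2))
                - (d * h (x *m B1) + d * h (z *m B2))); last by ring.
  rewrite xE zE /d !(rmorphD, rmorphM, rmorph1) /= -/ac.
  by ring.
apply: norm_lt1_of_schur quad; nra.
Qed.

(** Strict bounds at finitely many points are uniformly strict. The radius
    [0] serves the empty list, i.e. the matrix of size [0]. *)
Lemma bound_lt1 (R : rcfType) (s : seq R[i]) :
  (forall z, z \in s -> `|z - 1| < 1) ->
  exists2 r : R, r < 1 & forall z, z \in s -> `|z - 1| <= r%:C.
Proof.
elim: s => [_|z s IHs s_lt1]; first by exists 0; rewrite ?ltr01.
have [|r r_lt1 le_r] := IHs; first by move=> t ts; rewrite s_lt1 // inE ts orbT.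
have := s_lt1 z (mem_head _ _); rewrite normc_def -[X in _ < X]/(1%:C) ltcR.
set m := Num.sqrt _ => m_lt1.
exists (Num.max m r); first by rewrite gt_max m_lt1.
move=> t; rewrite inE => /predU1P[->|ts].
  by rewrite normc_def lecR le_max lexx.
by apply: le_trans (le_r t ts) _; rewrite lecR le_max lexx orbT.
Qed.

Theorem theorem2 (R : realType) (p n q : nat)
    (A1 : 'M[R]_(p, n)) (A2 : 'M[R]_(q, n)) (S : 'M[R]_n) (alpha : R)
    (hA1 : \rank A1 = n)
    (hA : spdmx (A1^T *m A1 - A2^T *m A2))
    (hS : spdmx S)
    (halpha : 0 < alpha) :
  (forall mu : R[i],
     ceigenvalue (invmx (P_BRS A1 A2 S alpha) *m K_mx A1 A2) mu ->
     `|mu - 1| < 1) /\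
  (exists r : R, r < 1 /\
     forall mu : R[i],
       ceigenvalue (invmx (P_BRS A1 A2 S alpha) *m K_mx A1 A2) mu ->
       `|mu - 1| <= r%:C).
Proof.
have disc mu : ceigenvalue (invmx (P_BRS A1 A2 S alpha) *m K_mx A1 A2) mu ->
    `|mu - 1| < 1.
  have P_unit := P_BRS_unit _ _ _ _ A1 A2 S alpha hS halpha.
  case/eigenvalueP=> v; rewrite map_mxM map_invmx mulmxA => vE v_neq0.
  have Pc_unit : map_mx (real_complex R) (P_BRS A1 A2 S alpha) \in unitmx.
    by rewrite map_unitmx.
  apply: pencil_lt1 hA hS halpha _ (etrans vE _).
    apply: contraNneq v_neq0 => w0.
    by rewrite -[v](mulmxKV Pc_unit) w0 mul0mx.
  by rewrite mulmxKV.
split=> //.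
set M := invmx _ *m _ in disc *.
pose f := char_poly (map_mx (real_complex R) M).
have [rs fE] := closed_field_poly_normal f.
have memE mu : ceigenvalue M mu <-> mu \in rs.
  rewrite /ceigenvalue eigenvalue_root_char -/f fE.
  by rewrite (monicP (char_poly_monic _)) scale1r root_prod_XsubC.
have [r r_lt1 le_r] : exists2 r : R, r < 1 & forall z, z \in rs -> `|z - 1| <= r%:C.
  by apply: bound_lt1 => z /memE /disc.
by exists r; split=> // mu /memE /le_r.
Qed.
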